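(* Let $w \ge 0$ and $N \ge 1$ be integers. If there is a strategy that, using at most $w$ weighings, is guaranteed to find the alternator among $N$ coins when the alternator starts in the $f$-state, then $N \le J_{w+2}$. If there is such a strategy using at most $w$ weighings when the alternator starts in the $r$-state, or when its starting state is unknown, then $N \le J_{w+1}$. Here $J_m = (2^m-(-1)^m)/3$.
   Context: Setting (alternator coin problem): There are $N$ identical-looking coins. All but one are real and have the same weight. The remaining coin, the alternator, behaves as follows: each time it is placed on a balance scale it weighs either the same as a real coin (''acts real'') or strictly less than a real coin (''acts fake''), and it switches between these two behaviours every time it is on the scale; while off the scale its behaviour does not change. A weighing places two disjoint sets of coins with the same number of coins on the two pans, and its outcome is one of: the pans balance, the left pan is lighter, or the right pan is lighter. Weighings may be chosen adaptively based on earlier outcomes. A strategy finds the alternator if, for every possible identity of the alternator, the outcomes determine which coin it is. The alternator is in the $f$-state if the next time it is on the scale it will act fake, and in the $r$-state if the next time it is on the scale it will act real; ''unknown starting state'' means it may start in either state. $J_m = (2^m-(-1)^m)/3$ is the $m$-th Jacobsthal number ($J_0=0,J_1=1,J_2=1,J_3=3,J_4=5,\dots$). *)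

(* Defs.v *)
From mathcomp Require Import all_boot all_order all_algebra.

Set Implicit Arguments.
Unset Strict Implicit.
Unset Printing Implicit Defensive.

Import Order.TTheory GRing.Theory Num.Theory.
Local Open Scope ring_scope.

Inductive outcome := Balanced | LeftLighter | RightLighter.

(* FState: acts fake the next time it is on the scale; RState: acts real. *)
Inductive alt_state := FState | RState.

Definition switch (s : alt_state) : alt_state :=
  match s with FState => RState | RState => FState end.

Record weighing (N : nat) := Weighing {
  left_pan : {set 'I_N};
  right_pan : {set 'I_N};
  pans_disjoint : [disjoint left_pan & right_pan];
  pans_same_card : #|left_pan| = #|right_pan| }.

Inductive strategy (N : nat) :=
  | Stop
  | Weigh (p : weighing N) (next : outcome -> strategy N).

Arguments Stop {N}.

Definition coin_weight (R : realFieldType) (real_w fake_w : R) (N : nat)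
    (a : 'I_N) (s : alt_state) (c : 'I_N) : R :=
  if c == a then match s with FState => fake_w | RState => real_w end
  else real_w.

Definition weigh (R : realFieldType) (real_w fake_w : R) (N : nat)
    (a : 'I_N) (s : alt_state) (p : weighing N) : outcome :=
  let lw := \sum_(c in left_pan p) coin_weight real_w fake_w a s c in
  let rw := \sum_(c in right_pan p) coin_weight real_w fake_w a s c in
  if lw < rw then LeftLighter
  else if rw < lw then RightLighter
  else Balanced.

Definition next_state (N : nat) (a : 'I_N) (s : alt_state) (p : weighing N) :
    alt_state :=
  if (a \in left_pan p) || (a \in right_pan p) then switch s else s.

(* The outcomes observed when the alternator is coin a, initially in state s. *)
Fixpoint transcript (R : realFieldType) (real_w fake_w : R) (N : nat)
    (a : 'I_N) (s : alt_state) (S : strategy N) : seq outcome :=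
  match S with
  | Stop => [::]
  | Weigh p next =>
      let o := weigh real_w fake_w a s p in
      o :: transcript real_w fake_w a (next_state a s p) (next o)
  end.

(* start is the set of starting states the strategy has to cope with. Only the
   identity of the alternator has to be determined, not its state. *)
Definition finds_alternator (R : realFieldType) (real_w fake_w : R) (N : nat)
    (start : alt_state -> Prop) (S : strategy N) : Prop :=
  forall (a a' : 'I_N) (s s' : alt_state), start s -> start s' ->
    transcript real_w fake_w a s S = transcript real_w fake_w a' s' S ->
    a = a'.

Definition uses_at_most (R : realFieldType) (real_w fake_w : R) (N w : nat)
    (start : alt_state -> Prop) (S : strategy N) : Prop :=
  forall (a : 'I_N) (s : alt_state), start s ->
    (size (transcript real_w fake_w a s S) <= w)%N.

Definition solvable_within (R : realFieldType) (real_w fake_w : R) (N w : nat)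
    (start : alt_state -> Prop) : Prop :=
  exists S : strategy N,
    uses_at_most real_w fake_w w start S /\
    finds_alternator real_w fake_w start S.

Definition starts_f (s : alt_state) : Prop := s = FState.
Definition starts_r (s : alt_state) : Prop := s = RState.
Definition starts_unknown (_ : alt_state) : Prop := True.

Definition jacobsthal (m : nat) : rat := (2 ^+ m - (-1) ^+ m) / 3.

(* Main.v *)
Require Import Defs.
From mathcomp Require Import all_boot all_order all_algebra.
From mathcomp Require Import ring.

Import Order.TTheory GRing.Theory Num.Theory.
Local Open Scope ring_scope.

(** Follow a set [A] of candidate coins, each with its own presumed state,
through a strategy that separates them in [w] weighings. An unbalanced weighing
can only come from a coin that acted fake, so every surviving candidate is then
in the r-state; and a set of r-state candidates always produces a balance. Hence
the largest sizes [f w] of an arbitrary and [r w] of an all-r candidate set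
satisfy [f (w+1) <= f w + 2 r w] and [r (w+1) <= f w], which is the Jacobsthal
recurrence. A strategy coping with an unknown state also copes with the
r-state. *)

(** The Jacobsthal numbers by their recurrence, so that the counting stays in [nat]. *)
Fixpoint jacn (m : nat) : nat :=
  match m with
  | 0 => 0
  | 1 => 1
  | (m'.+1 as k).+1 => jacn k + 2 * jacn m'
  end.

Lemma jacnSS m : jacn m.+2 = (jacn m.+1 + 2 * jacn m)%N.
Proof. by []. Qed.

Lemma jacn_gt0 m : (0 < jacn m.+1)%N.
Proof. by elim: m => // m IHm; rewrite jacnSS addn_gt0 IHm. Qed.

Lemma jacobsthal_jacn m : jacobsthal m = (jacn m)%:R.
Proof.
suff: jacobsthal m = (jacn m)%:R /\ jacobsthal m.+1 = (jacn m.+1)%:R by case.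
elim: m => [|m [IH0 IH1]]; first by split.
split=> //; rewrite jacnSS natrD natrM -IH0 -IH1 /jacobsthal !exprS.
by field.
Qed.

Definition same_outcome (o o' : outcome) : bool :=
  match o, o' with
  | Balanced, Balanced | LeftLighter, LeftLighter
  | RightLighter, RightLighter => true
  | _, _ => false
  end.

Lemma same_outcomeP o o' : reflect (o = o') (same_outcome o o').
Proof. by case: o; case: o'; constructor. Qed.

Lemma card_split_outcome (T : finType) (f : T -> outcome) (A : {set T}) :
  #|A| = (#|[set x in A | same_outcome (f x) Balanced]|
        + #|[set x in A | same_outcome (f x) LeftLighter]|
        + #|[set x in A | same_outcome (f x) RightLighter]|)%N.
Proof.
have card_sub P : #|[set x in A | P x]| = (\sum_(x in A) P x)%N.
  by rewrite -sum1dep_card big_mkcondr; apply: eq_bigr => x _; case: (P x).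
rewrite !card_sub -!big_split -sum1_card /=; apply: eq_bigr => x _.
by case: (f x).
Qed.

Section Candidates.

Variables (R : realFieldType) (real_w fake_w : R) (N : nat).

(** Pans of equal cardinality then both weigh the same multiple of [real_w]. *)
Lemma weigh_all_real (a : 'I_N) s (p : weighing N) :
  (forall c, (c \in left_pan p) || (c \in right_pan p) ->
     coin_weight real_w fake_w a s c = real_w) ->
  weigh real_w fake_w a s p = Balanced.
Proof.
move=> real_c; rewrite /weigh.
have -> : \sum_(c in left_pan p) coin_weight real_w fake_w a s c
          = real_w *+ #|left_pan p|.
  by rewrite -sumr_const; apply: eq_bigr => c cl; rewrite real_c ?cl.
have -> : \sum_(c in right_pan p) coin_weight real_w fake_w a s c
          = real_w *+ #|right_pan p|.
  by rewrite -sumr_const; apply: eq_bigr => c cr; rewrite real_c ?cr ?orbT.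
by rewrite pans_same_card ltxx.
Qed.

Lemma weigh_RState (a : 'I_N) (p : weighing N) :
  weigh real_w fake_w a RState p = Balanced.
Proof.
by apply: weigh_all_real => c _; rewrite /coin_weight; case: (c == a).
Qed.

(** Imbalance rules out the r-state and an alternator off the scale, so an f-state alternator was
    weighed and has switched. *)
Lemma unbalanced_next_state (a : 'I_N) s (p : weighing N) :
  weigh real_w fake_w a s p <> Balanced -> next_state a s p = RState.
Proof.
case: s => [unbal|]; last by rewrite weigh_RState.
rewrite /next_state; case: ifPn => // off; case: unbal.
apply: weigh_all_real => c on_c; rewrite /coin_weight.
by case: eqP => // c_a; rewrite -c_a on_c in off.
Qed.

(** Induction on [S]. The state [st] depends on the coin because a weighing switches only the
    candidates placed on the scale. *)
Lemma card_candidates (S : strategy N) (w : nat) (A : {set 'I_N})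
    (st : 'I_N -> alt_state) :
  {in A, forall a, (size (transcript real_w fake_w a (st a) S) <= w)%N} ->
  {in A &, injective (fun a => transcript real_w fake_w a (st a) S)} ->
  (#|A| <= jacn w.+2)%N /\
  ({in A, forall a, st a = RState} -> (#|A| <= jacn w.+1)%N).
Proof.
elim: S w A st => [|p next IH] w A st size_le inj.
  (* At [Stop] every transcript is empty, so separation leaves at most one candidate. *)
  have A_le1 : (#|A| <= 1)%N by apply/card_le1_eqP => a b aA bA; apply: inj.
  by split=> [|_]; apply: leq_trans A_le1 (jacn_gt0 _).
case: w size_le => [|w] size_le.
  (* A transcript starting with a weighing cannot have length 0. *)
  have -> : A = set0 by apply/setP => a; rewrite inE; apply/negP => /size_le.
  by rewrite cards0.
pose f a := weigh real_w fake_w a (st a) p.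
pose st' a := next_state a (st a) p.
pose B o := [set a in A | same_outcome (f a) o].
have BP o a : a \in B o -> a \in A /\ f a = o.
  by rewrite inE => /andP [aA /same_outcomeP].
have IHB o : (#|B o| <= jacn w.+2)%N /\
    ({in B o, forall a, st' a = RState} -> (#|B o| <= jacn w.+1)%N).
  apply: (IH o) => [a /BP [aA <-]|a b /BP [aA fa] /BP [bA fb] eq_tr].
    by have := size_le a aA.
  (* Members of [B o] share the first outcome, so their tails must differ. *)
  by apply: inj => //=; rewrite -/(f a) -/(f b) fa fb; congr cons.
have unbal o : o <> Balanced -> (#|B o| <= jacn w.+1)%N.
  move=> o_unbal; apply: (proj2 (IHB o)) => a /BP [_ fa].
  by apply: unbalanced_next_state; rewrite -/(f a) fa.
split=> [|stR].
  (* One summand of the recurrence bounds each outcome class. *)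
  rewrite (card_split_outcome _ f) jacnSS mul2n -addnn addnA.
  by rewrite !leq_add ?unbal //; apply: (proj1 (IHB Balanced)).
(* All r-state candidates balance, so the general bound for one weighing fewer applies. *)
suff -> : A = B Balanced by case: (IHB Balanced).
apply/setP => a; rewrite inE; case: (boolP (a \in A)) => //= aA.
by rewrite /f stR // weigh_RState.
Qed.

Lemma solvable_within_sub (P Q : alt_state -> Prop) (w : nat) :
  (forall s, P s -> Q s) ->
  solvable_within real_w fake_w N w Q -> solvable_within real_w fake_w N w P.
Proof.
move=> PQ [S [use find]]; exists S.
split=> [a s /PQ|a a' s s' /PQ Qs /PQ Qs']; [exact: use | exact: find].
Qed.

Lemma card_solvable (s : alt_state) (w : nat) :
  solvable_within real_w fake_w N w (fun s' => s' = s) ->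
  (N <= jacn w.+2)%N /\ (s = RState -> (N <= jacn w.+1)%N).
Proof.
move=> [S [use find]].
(* Initially every coin is a candidate, in the common state [s]. *)
have [] := @card_candidates S w [set: 'I_N] (fun=> s).
- by move=> a _; apply: use.
- by move=> a b _ _; apply: find.
by rewrite cardsT card_ord => le2 le1; split=> // sR; apply: le1.
Qed.

End Candidates.

Theorem mainTheorem4 (R : realFieldType) (real_w fake_w : R)
    (fake_lt_real : fake_w < real_w) (w N : nat) (N_gt0 : (1 <= N)%N) :
  (solvable_within real_w fake_w N w starts_f ->
     N%:R <= jacobsthal (w + 2)) /\
  (solvable_within real_w fake_w N w starts_r \/
   solvable_within real_w fake_w N w starts_unknown ->
     N%:R <= jacobsthal (w + 1)).
Proof.
rewrite !jacobsthal_jacn !ler_nat addn1 addn2.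
split=> [/(@card_solvable _ _ _ _ FState) [] //|solv].
have solv_r : solvable_within real_w fake_w N w starts_r.
  by case: solv => //; apply: solvable_within_sub.
by have [_] := @card_solvable _ _ _ _ RState _ solv_r; apply.
Qed.
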